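(* Let $p$ be an odd prime. For all $m, n, s, k \in \mathbb{Z}_+=\{0,1,2,\dots\}$ with $m+n+s > 3k$, $$\int_{\mathbb{Z}_p} B_{k,n}(x)B_{k,m}(x)B_{k,s}(x)\, d\mu_{-1}(x) = \begin{cases} 2+E_{n+m+s} & \text{if } k=0,\\[2mm] \displaystyle\binom{n}{k}\binom{m}{k}\binom{s}{k}\sum_{j=0}^{3k}\binom{3k}{j}(-1)^{3k-j}E_{n+m+s-j} & \text{if } k>0.\end{cases}$$
   Context: For a uniformly differentiable function $f:\mathbb{Z}_p \to \mathbb{C}_p$ (in particular any polynomial), the fermionic $p$-adic invariant integral on $\mathbb{Z}_p$ is $$\int_{\mathbb{Z}_p} f(x)\, d\mu_{-1}(x) = \lim_{N\to\infty} \sum_{x=0}^{p^N-1} f(x)(-1)^x,$$ where the limit is taken in the $p$-adic topology. For $k,n\in\mathbb{Z}_+$ the Bernstein polynomial is $B_{k,n}(x) = \binom{n}{k} x^k (1-x)^{n-k}$ for $k \le n$, and $B_{k,n}(x)=0$ for $n<k$ (where $\binom{n}{k}=0$). The Euler numbers $E_n\in\mathbb{Q}$ ($n\ge 0$) are defined by $\frac{2}{e^t+1} = \sum_{n=0}^{\infty} E_n \frac{t^n}{n!}$ and are regarded as elements of $\mathbb{Q}_p$. *)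

(* Defs.v *)
From HB Require Import structures.
From mathcomp Require Import all_boot all_order all_algebra.
From mathcomp Require Import fraction generic_quotient.
From mathcomp Require Import all_classical.
From mathcomp Require Import topology.

Set Implicit Arguments.
Unset Strict Implicit.
Unset Printing Implicit Defensive.

Import Order.TTheory GRing.Theory Num.Theory.
Local Open Scope classical_set_scope.
Local Open Scope ring_scope.

(* Z_p as the inverse limit of the Z/p^n: component n is the representative   *)
(* in {0, .., p^n - 1} of the residue mod p^n. For n = 0 the component is 0.  *)
(* The primality proof is a parameter of the type only so that the integral   *)
(* domain structure can be inferred.                                          *)
Record padic_int (p : nat) (p_pr : prime p) := PadicInt {
  residue :> nat -> nat;
  _ : `[< forall n, (residue n.+1 %% p ^ n)%N = residue n >] }.

HB.instance Definition _ p (p_pr : prime p) := [isSub for @residue p p_pr].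
HB.instance Definition _ p (p_pr : prime p) :=
  [Choice of padic_int p_pr by <:].

Section PadicInt.
Variables (p : nat) (p_pr : prime p).
Local Notation Zp := (padic_int p_pr).
Implicit Types x y z : Zp.

Let p_gt0 n : (0 < p ^ n)%N. Proof. by rewrite expn_gt0 prime_gt0. Qed.

Let dvdpS n : (p ^ n %| p ^ n.+1)%N. Proof. exact: dvdn_exp2l. Qed.

Lemma padic_eq x y : (forall n, x n = y n) -> x = y.
Proof. by move=> xy; apply: val_inj; apply/funext. Qed.

Lemma residueS x n : (x n.+1 %% p ^ n)%N = x n.
Proof. by case: x => f /= /asboolP ->. Qed.

Lemma residue_mod x n : (x n %% p ^ n)%N = x n.
Proof. by rewrite -residueS modn_mod. Qed.

Lemma residue_le x m n : (m <= n)%N -> (x n %% p ^ m)%N = x m.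
Proof.
move=> /subnK <-; elim: (n - m)%N => [|d IH]; first exact: residue_mod.
by rewrite addSn -IH -[in RHS]residueS modn_dvdm // dvdn_exp2l // leq_addl.
Qed.

Lemma residue0 x : x 0%N = 0%N.
Proof. by rewrite -residue_mod modn1. Qed.

Fact padic_mk_subproof (f : nat -> nat) :
  (forall n, f n.+1 = f n %[mod p ^ n])%N ->
  `[< forall n, ((f n.+1 %% p ^ n.+1) %% p ^ n)%N = (f n %% p ^ n)%N >].
Proof. by move=> fS; apply/asboolP => n; rewrite modn_dvdm. Qed.

Definition padic_mk f fS : Zp := PadicInt p_pr (@padic_mk_subproof f fS).

Fact padic_nat_subproof (a : nat) n : (a = a %[mod p ^ n])%N.
Proof. by []. Qed.
Definition padic_nat (a : nat) : Zp := padic_mk (padic_nat_subproof a).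

Fact padic_add_subproof x y n : (x n.+1 + y n.+1 = x n + y n %[mod p ^ n])%N.
Proof. by rewrite -modnDm !residueS. Qed.
Definition padic_add x y := padic_mk (padic_add_subproof x y).

Fact padic_mul_subproof x y n : (x n.+1 * y n.+1 = x n * y n %[mod p ^ n])%N.
Proof. by rewrite -modnMm !residueS. Qed.
Definition padic_mul x y := padic_mk (padic_mul_subproof x y).

Fact padic_opp_subproof x n :
  (p ^ n.+1 - x n.+1 = p ^ n - x n %[mod p ^ n])%N.
Proof.
have lt m : (x m <= p ^ m)%N by rewrite -residue_mod ltnW // ltn_mod.
apply/eqP; rewrite -(eqn_modDr (x n.+1)) subnK //.
rewrite -modnDmr residueS subnK // modnn.
by rewrite -/(dvdn _ _).
Qed.
Definition padic_opp x := padic_mk (padic_opp_subproof x).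

Fact padic_addA : associative padic_add.
Proof. by move=> x y z; apply: padic_eq => n /=; rewrite modnDml modnDmr addnA. Qed.
Fact padic_addC : commutative padic_add.
Proof. by move=> x y; apply: padic_eq => n /=; rewrite addnC. Qed.
Fact padic_add0 : left_id (padic_nat 0) padic_add.
Proof. by move=> x; apply: padic_eq => n /=; rewrite mod0n residue_mod. Qed.
Fact padic_addN : left_inverse (padic_nat 0) padic_opp padic_add.
Proof.
move=> x; apply: padic_eq => n /=; rewrite modnDml subnK ?modnn ?mod0n //.
by rewrite -residue_mod ltnW // ltn_mod.
Qed.
HB.instance Definition _ :=
  GRing.isZmodule.Build Zp padic_addA padic_addC padic_add0 padic_addN.

Fact padic_mulA : associative padic_mul.
Proof. by move=> x y z; apply: padic_eq => n /=; rewrite modnMml modnMmr mulnA. Qed.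
Fact padic_mulC : commutative padic_mul.
Proof. by move=> x y; apply: padic_eq => n /=; rewrite mulnC. Qed.
Fact padic_mul1 : left_id (padic_nat 1) padic_mul.
Proof. by move=> x; apply: padic_eq => n /=; rewrite modnMml mul1n residue_mod. Qed.
Fact padic_mulDl : left_distributive padic_mul padic_add.
Proof.
by move=> x y z; apply: padic_eq => n /=; rewrite modnMml modnDm mulnDl.
Qed.
Fact padic_1neq0 : padic_nat 1 != 0.
Proof.
apply/eqP => /(congr1 (fun x : Zp => x 1%N)) /=.
by rewrite mod0n modn_small // expn1 prime_gt1.
Qed.
HB.instance Definition _ := GRing.Zmodule_isComNzRing.Build Zp
  padic_mulA padic_mulC padic_mul1 padic_mulDl padic_1neq0.

Lemma residueD x y n : (x + y) n = ((x n + y n) %% p ^ n)%N. Proof. by []. Qed.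
Lemma residueM x y n : (x * y) n = ((x n * y n) %% p ^ n)%N. Proof. by []. Qed.
Lemma residue_zero n : (0 : Zp) n = 0%N. Proof. by rewrite /= mod0n. Qed.
Lemma residueN_eq0 x n : ((- x) n == 0%N) = (x n == 0%N).
Proof.
have /eqP : (- x + x) n = 0%N by rewrite addNr residue_zero.
rewrite residueD => h; apply/eqP/eqP => h'; move: h; rewrite h' ?addn0 ?add0n.
  by rewrite residue_mod => /eqP.
by rewrite residue_mod => /eqP.
Qed.
Lemma residue_nat (a n : nat) : (a%:R : Zp) n = (a %% p ^ n)%N.
Proof.
elim: a => [|a IH]; first by rewrite residue_zero mod0n.
by rewrite -addn1 natrD residueD IH /= modnDm.
Qed.

Lemma padic_neq0 x : x != 0 -> exists n, x n.+1 != 0%N.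
Proof.
move=> x0; apply: contrapT => nx; move/eqP: x0; apply; apply: padic_eq => n.
rewrite residue_zero; case: n => [|n]; first exact: residue0.
by apply: contrapT => /eqP h; apply: nx; exists n.
Qed.

(* The p-adic valuation, with the junk value 0 at 0. *)
Definition padic_val x : nat :=
  if pselect (exists n, x n.+1 != 0%N) is left ex then ex_minn ex else 0%N.

Lemma padic_valP x n : x != 0 -> (x n == 0%N) = (n <= padic_val x)%N.
Proof.
move=> /padic_neq0 ex; rewrite /padic_val; case: pselect => // {}ex.
case: ex_minnP => v xv vmin; apply/idP/idP => [xn|].
  rewrite leqNgt; apply/negP => /(residue_le x).
  by rewrite (eqP xn) mod0n => /esym/eqP; apply/negP.
case: n => [|n nv]; first by rewrite residue0.
by apply: contraT => /vmin; rewrite leqNgt nv.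
Qed.

Lemma dvdn_residue x m n : (m <= n)%N -> (p ^ m %| x n)%N = (x m == 0%N).
Proof. by move=> mn; rewrite /dvdn residue_le. Qed.

Lemma logn_residue x n : x != 0 -> (padic_val x < n)%N ->
  (0 < x n)%N /\ logn p (x n) = padic_val x.
Proof.
move=> x0 vn; have xn0 : (0 < x n)%N by rewrite lt0n padic_valP // -ltnNge.
split=> //; apply/eqP; rewrite eqn_leq leqNgt.
rewrite -!pfactor_dvdn // !dvdn_residue ?padic_valP ?ltnn ?leqnn //.
exact: ltnW.
Qed.

Lemma padicM_eq0 x y n : x != 0 -> y != 0 ->
  ((x * y) n == 0%N) = (n <= padic_val x + padic_val y)%N.
Proof.
move=> x0 y0; set v := (_ + _)%N.
set N := maxn n v.+1; have nN : (n <= N)%N by exact: leq_maxl.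
have vN : (v < N)%N by exact: leq_maxr.
have [xN lx] : _ /\ _ := logn_residue x0 (leq_ltn_trans (leq_addr _ _) vN).
have [yN ly] : _ /\ _ := logn_residue y0 (leq_ltn_trans (leq_addl _ _) vN).
rewrite -(dvdn_residue _ nN) residueM /dvdn modn_dvdm ?dvdn_exp2l //.
by rewrite -/(dvdn _ _) pfactor_dvdn ?muln_gt0 ?xN // lognM // lx ly.
Qed.

Fact padic_integral x y : x * y = 0 -> (x == 0) || (y == 0).
Proof.
move=> xy0; have [//|x0] := eqVneq x 0; have [//|y0] := eqVneq y 0.
have := padicM_eq0 (padic_val x + padic_val y).+1 x0 y0.
by rewrite xy0 residue_zero eqxx ltnn.
Qed.

Lemma padic_valM x y : x != 0 -> y != 0 ->
  padic_val (x * y) = (padic_val x + padic_val y)%N.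
Proof.
move=> x0 y0.
have xy0 : x * y != 0.
  by apply/eqP => /padic_integral; rewrite (negbTE x0) (negbTE y0).
apply/eqP; rewrite eqn_leq; apply/andP; split.
  by rewrite -padicM_eq0 // padic_valP.
by rewrite -padic_valP // padicM_eq0.
Qed.

Definition padic_unit : pred Zp := fun x => `[< exists y, y * x = 1 >].
Definition padic_inv x : Zp :=
  if pselect (exists y, y * x = 1) is left ex then sval (cid ex) else x.

Fact padic_mulV : {in padic_unit, left_inverse 1 padic_inv *%R}.
Proof.
move=> x /asboolP ex; rewrite /padic_inv; case: pselect => // {}ex.
exact: (svalP (cid ex)).
Qed.
Fact padic_unitP x y : y * x = 1 -> padic_unit x.
Proof. by move=> yx; apply/asboolP; exists y. Qed.
Fact padic_inv_out : {in [predC padic_unit], padic_inv =1 id}.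
Proof.
move=> x; rewrite inE => /asboolP nex.
by rewrite /padic_inv; case: pselect.
Qed.
HB.instance Definition _ :=
  GRing.ComNzRing_hasMulInverse.Build Zp padic_mulV padic_unitP padic_inv_out.
HB.instance Definition _ :=
  GRing.ComUnitRing_isIntegral.Build Zp padic_integral.

Definition padic_int_norm x : rat :=
  if x == 0 then 0 else p%:R ^- padic_val x.

Let pR_gt0 : 0 < p%:R :> rat. Proof. by rewrite ltr0n prime_gt0. Qed.

Lemma padic_int_norm_ge0 x : 0 <= padic_int_norm x.
Proof.
by rewrite /padic_int_norm; case: ifP => // _; rewrite invr_ge0 exprn_ge0 ?ltW.
Qed.

Lemma padic_int_norm_eq0 x : (padic_int_norm x == 0) = (x == 0).
Proof.
rewrite /padic_int_norm; case: (eqVneq x 0) => [_|x0]; first by rewrite eqxx.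
by apply: gt_eqF; rewrite invr_gt0 exprn_gt0.
Qed.

Lemma padic_int_normM x y :
  padic_int_norm (x * y) = padic_int_norm x * padic_int_norm y.
Proof.
rewrite /padic_int_norm mulf_eq0.
case: (eqVneq x 0) => [_|x0]; first by rewrite mul0r.
case: (eqVneq y 0) => [_|y0]; first by rewrite mulr0.
by rewrite padic_valM // exprD invfM.
Qed.

Lemma padic_int_normN x : padic_int_norm (- x) = padic_int_norm x.
Proof.
rewrite /padic_int_norm oppr_eq0; case: (eqVneq x 0) => // x0.
have nx0 : - x != 0 by rewrite oppr_eq0.
congr (_ ^- _); apply/eqP; rewrite eqn_leq -(padic_valP _ x0) -(padic_valP _ nx0).
by rewrite residueN_eq0 -(residueN_eq0 x (padic_val (- x))) !padic_valP // !leqnn.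
Qed.

Lemma padic_int_norm_le_exp x n :
  (padic_int_norm x <= p%:R ^- n) = (x n == 0%N).
Proof.
rewrite /padic_int_norm; case: (eqVneq x 0) => [->|x0].
  by rewrite residue_zero eqxx invr_ge0 exprn_ge0 // ltW.
rewrite padic_valP // lef_pV2 ?posrE ?exprn_gt0 //.
by rewrite ler_eXn2l // ltr1n prime_gt1.
Qed.

Lemma padic_int_normD x y :
  padic_int_norm (x + y) <= Num.max (padic_int_norm x) (padic_int_norm y).
Proof.
have [->|x0] := eqVneq x 0; first by rewrite add0r le_max lexx orbT.
have [->|y0] := eqVneq y 0; first by rewrite addr0 le_max lexx.
wlog xy : x y x0 y0 / padic_int_norm x <= padic_int_norm y.
  have [h|/ltW h] := leP (padic_int_norm x) (padic_int_norm y) => W.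
    by have := W x y x0 y0 h; rewrite (max_idPr h).
  by have := W y x y0 x0 h; rewrite (max_idPr h) addrC.
rewrite (max_idPr xy); move: (xy); rewrite {2 4}/padic_int_norm (negbTE y0).
rewrite !padic_int_norm_le_exp residueD => /eqP ->.
by rewrite add0n residue_mod padic_valP.
Qed.

End PadicInt.

(* Q_p; an alias of the fraction field, so that the metric below is attached *)
(* to it.                                                                    *)
Definition padic (p : nat) (p_pr : prime p) : Type :=
  {fraction padic_int p_pr}.
HB.instance Definition _ p (p_pr : prime p) := GRing.Field.on (padic p_pr).

Section Padic.
Variables (p : nat) (p_pr : prime p).
Local Notation Zp := (padic_int p_pr).
Local Notation Qp := (padic p_pr).
Implicit Types x y z : Qp.
Local Open Scope quotient_scope.

Definition padic_of_int (x : Zp) : Qp := tofrac x.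
HB.instance Definition _ := GRing.RMorphism.copy padic_of_int (@tofrac Zp).

Lemma padic_of_int_inj : injective padic_of_int.
Proof. by move=> x y /eqP; rewrite tofrac_eq => /eqP. Qed.

(* The p-adic absolute value, normalized by |p| = 1/p. *)
Definition padic_norm x : rat :=
  let r : {ratio Zp} := repr (x : {fraction Zp}) in
  padic_int_norm \n_r / padic_int_norm \d_r.

Lemma padic_ratio x : exists ab : Zp * Zp,
  [/\ ab.2 != 0, x = padic_of_int ab.1 / padic_of_int ab.2
    & padic_norm x = padic_int_norm ab.1 / padic_int_norm ab.2].
Proof.
set r := repr (x : {fraction Zp}).
have d0 : \d_r != 0 := denom_ratioP r.
exists (\n_r, \d_r); split => //=.
have D0 : padic_of_int \d_r != 0 by rewrite /padic_of_int tofrac_eq0.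
apply: (mulIf D0); rewrite mulfVK // -[x in LHS](reprK x) -/r.
rewrite -[in LHS](Ratio_numden r) /padic_of_int; unlock FracField.tofrac.
rewrite -[LHS]FracField.pi_mul; apply/eqmodP.
rewrite /= FracField.equivfE /FracField.mulf !numden_Ratio ?oner_eq0 ?mulr1 //.
by rewrite mulrC.
Qed.

Lemma padic_norm_frac (a b : Zp) : b != 0 ->
  padic_norm (padic_of_int a / padic_of_int b) =
  padic_int_norm a / padic_int_norm b.
Proof.
move=> b0; have [[c d] /= [d0 e ->]] :=
  padic_ratio (padic_of_int a / padic_of_int b).
apply/eqP; rewrite eqr_div ?padic_int_norm_eq0 // -!padic_int_normM.
move/eqP: e; rewrite eqr_div ?tofrac_eq0 // -!rmorphM.
by move=> /eqP/padic_of_int_inj <-; rewrite eqxx.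
Qed.

Lemma padic_norm_int (a : Zp) : padic_norm (padic_of_int a) = padic_int_norm a.
Proof.
have := padic_norm_frac a (oner_neq0 Zp).
rewrite rmorph1 divr1 => ->.
have n1 : padic_int_norm (1 : Zp) != 0 by rewrite padic_int_norm_eq0 oner_eq0.
by apply: (mulIf n1); rewrite mulfVK // -padic_int_normM mulr1.
Qed.

Lemma padic_norm_eq0 x : (padic_norm x == 0) = (x == 0).
Proof.
have [[a b] /= [b0 -> ->]] := padic_ratio x.
rewrite !mulf_eq0 !invr_eq0 !padic_int_norm_eq0 (negbTE b0) /padic_of_int.
by rewrite !tofrac_eq0 (negbTE b0).
Qed.

Lemma padic_normN x : padic_norm (- x) = padic_norm x.
Proof.
have [[a b] /= [b0 -> ->]] := padic_ratio x.
by rewrite -mulNr -rmorphN padic_norm_frac //= padic_int_normN.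
Qed.

Lemma padic_normM x y : padic_norm (x * y) = padic_norm x * padic_norm y.
Proof.
have [[a b] /= [b0 -> ->]] := padic_ratio x.
have [[c d] /= [d0 -> ->]] := padic_ratio y.
by rewrite mulf_div -!rmorphM padic_norm_frac ?mulf_neq0 //= !padic_int_normM
  mulf_div.
Qed.

Lemma padic_normD x y :
  padic_norm (x + y) <= Num.max (padic_norm x) (padic_norm y).
Proof.
have [[a b] /= [b0 -> ->]] := padic_ratio x.
have [[c d] /= [d0 -> ->]] := padic_ratio y.
have gt0 (z : Zp) : z != 0 -> 0 < padic_int_norm z.
  by move=> z0; rewrite lt_def padic_int_norm_eq0 z0 padic_int_norm_ge0.
rewrite addf_div ?tofrac_eq0 // -!rmorphM -rmorphD padic_norm_frac ?mulf_neq0 //.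
rewrite ler_pdivrMr ?gt0 ?mulf_neq0 //.
rewrite maxr_pMl ?padic_int_norm_ge0 // !padic_int_normM.
rewrite mulrA divfK ?padic_int_norm_eq0 //.
rewrite [X in Num.max _ (_ * X)]mulrC mulrA divfK ?padic_int_norm_eq0 //.
by rewrite -!padic_int_normM padic_int_normD.
Qed.

Let padic_dist x y : rat := padic_norm (x - y).
Fact padic_distxx x : padic_dist x x = 0.
Proof. by apply/eqP; rewrite padic_norm_eq0 subrr. Qed.
Fact padic_dist_positivity x y : padic_dist x y = 0 -> x = y.
Proof. by move/eqP; rewrite padic_norm_eq0 subr_eq0 => /eqP. Qed.
Fact padic_dist_sym x y : padic_dist x y = padic_dist y x.
Proof. by rewrite /padic_dist -padic_normN opprB. Qed.
Fact padic_dist_triangle y x z :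
  padic_dist x z <= padic_dist x y + padic_dist y z.
Proof.
have ge0 w : 0 <= padic_norm w.
  have [[a b] /= [b0 _ ->]] := padic_ratio w.
  by rewrite divr_ge0 // padic_int_norm_ge0.
rewrite /padic_dist -[x - z](subrKA y); apply: le_trans (padic_normD _ _) _.
by rewrite ge_max lerDl lerDr !ge0.
Qed.

HB.instance Definition _ := isMetric.Build rat Qp
  padic_distxx padic_dist_positivity padic_dist_sym padic_dist_triangle.
HB.instance Definition _ := isPointed.Build Qp 0.

Lemma padic_mdistE x y : mdist x y = padic_norm (x - y).
Proof. by []. Qed.

Lemma padic_hausdorff : hausdorff_space Qp.
Proof. exact: metric_hausdorff. Qed.

(* Only functions with values in Q_p are considered: Q_p is complete, hence   *)
(* closed in C_p, so for such functions the limit below exists in Q_p as soon *)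
(* as it exists in C_p, and it is the same.                                   *)
Definition fermionic_sum (f : Zp -> Qp) (N : nat) : Qp :=
  \sum_(0 <= x < p ^ N) f x%:R * (-1) ^+ x.

Definition fermionic_integrable (f : Zp -> Qp) : Prop :=
  cvg (fermionic_sum f @ \oo).

Definition fermionic_integral (f : Zp -> Qp) : Qp :=
  lim (fermionic_sum f @ \oo).

End Padic.

Definition bernstein (R : comNzRingType) (k n : nat) : {poly R} :=
  if (k <= n)%N then 'C(n, k)%:R *: ('X ^+ k * (1 - 'X) ^+ (n - k)) else 0.

(* Formal power series are given by their coefficients. *)
Fixpoint fps_div_seq (F : fieldType) (a b : nat -> F) (n : nat) : seq F :=
  if n is m.+1 then
    let c := fps_div_seq a b m in
    rcons c ((a m - \sum_(i < m) c`_i * b (m - i)%N) / b 0%N)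
  else [::].

Definition fps_div (F : fieldType) (a b : nat -> F) (n : nat) : F :=
  (fps_div_seq a b n.+1)`_n.

Lemma fps_divP (F : fieldType) (a b : nat -> F) (n : nat) : b 0%N != 0 ->
  \sum_(i < n.+1) fps_div a b i * b (n - i)%N = a n.
Proof.
have sz m : size (fps_div_seq a b m) = m.
  by elim: m => //= m IH; rewrite size_rcons IH.
have nthE m i : (i < m)%N -> (fps_div_seq a b m)`_i = fps_div a b i.
  elim: m => // m IH; rewrite ltnS leq_eqVlt => /predU1P[->//|im] /=.
  by rewrite nth_rcons sz im IH.
move=> b0; rewrite big_ord_recr /= subnn {2}/fps_div /= nth_rcons sz ltnn eqxx.
rewrite divfK // (eq_bigr (fun i : 'I_n => (fps_div_seq a b n)`_i * b (n - i)%N)).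
  by rewrite addrC subrK.
by move=> i _; rewrite nthE.
Qed.

Definition fps_exp (n : nat) : rat := n`!%:R^-1.
Definition fps_const (c : rat) (n : nat) : rat := if n == 0%N then c else 0.

Definition euler_number (n : nat) : rat :=
  n`!%:R * fps_div (fps_const 2) (fps_exp \+ fps_const 1) n.

Lemma euler_numberP (n : nat) :
  \sum_(i < n.+1) euler_number i / i`!%:R * (fps_exp \+ fps_const 1) (n - i)%N
  = fps_const 2 n.
Proof.
rewrite -(@fps_divP _ (fps_const 2) (fps_exp \+ fps_const 1)) //.
apply: eq_bigr => i _; rewrite /euler_number mulrC [X in _ * X]mulrAC divff ?mul1r.
  by rewrite mulrC.
by rewrite pnatr_eq0 -lt0n fact_gt0.
Qed.

(* Main.v *)
(* Every polynomial P over a field of characteristic 0 has the form             *)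
(* Q(X + 1) + Q(X). The alternating sum of such a P over 0 <= x < p^N           *)
(* telescopes to Q(0) + Q(p^N) and so tends to 2 Q(0); the umbral functional    *)
(* E sending X^n to E_n takes the same value on P by the recurrence of the      *)
(* Euler numbers. Hence the integral of P is E(P). If P = Q(X + 1) + Q(X), then *)
(* P(-1 - X) arises in the same way from Q(-X), so E(P(-1 - X)) = E(P), and two *)
(* shifts give E(P(1 - X)) = E(P) + 2 P(1) - 2 P(0). Apply this to              *)
(* P = X^(n+m+s-3k) (1 - X)^(3k), for which P(0) = 0 and P(1) = [k = 0].        *)

Require Import Defs.
From HB Require Import structures.
From mathcomp Require Import all_boot all_order all_algebra.
From mathcomp Require Import all_classical topology.
From mathcomp Require Import ring zify.

Set Implicit Arguments.
Unset Strict Implicit.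
Unset Printing Implicit Defensive.

Import Order.TTheory GRing.Theory Num.Theory.
Local Open Scope ring_scope.

(** Why the reflection is used: up to the binomial factors the integrand is X^(3k) (1 - X)^(M - 3k)
    with M = n + m + s, whose direct expansion has M - 3k + 1 terms. It is S(1 - X) for S = X^(M -
    3k) (1 - X)^(3k), and expanding S takes only 3k + 1 terms, which are those of the theorem. The
    integral equals the Euler functional by [shift_sum_surj], [fermionic_sum_shift_sum] and
    [euler_eval_shift_sum], which meet in [fermionic_sum_horner_cvg]; [euler_eval_1subX] then
    replaces S(1 - X) by S at the cost of boundary values. *)

(** * Rational numbers inside a field of characteristic 0 *)

Section RatrPchar0.

Context (F : fieldType) (F0 : [pchar F] =i pred0).

Lemma pchar0_intr_eq0 (z : int) : (z%:~R == 0 :> F) = (z == 0).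
Proof.
case: z => n; first by rewrite -pmulrn ((pcharf0P F).1 F0).
by rewrite NegzE mulrNz -pmulrn oppr_eq0 ((pcharf0P F).1 F0).
Qed.

(** [ratr] reads off the reduced fraction; any other representation agrees with it by
    cross-multiplication, since nonzero integers stay nonzero in [F]. *)
Lemma pchar0_ratr_frac (a b : int) :
  b != 0 -> ratr (a%:~R / b%:~R) = a%:~R / b%:~R :> F.
Proof.
move=> b0; set x : rat := a%:~R / b%:~R.
have bQ0 : b%:~R != 0 :> rat by rewrite intr_eq0.
have e : numq x * b = a * denq x.
  apply: (@intr_inj rat); rewrite !rmorphM /= numqE mulrAC.
  by rewrite /x divfK.
apply/eqP; rewrite /ratr eqr_div ?pchar0_intr_eq0 ?denq_eq0 //.
by rewrite -!rmorphM /= e.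
Qed.

Lemma pchar0_ratr_zmod_morphism : zmod_morphism (@ratr F).
Proof.
move=> x y; rewrite -[x in LHS]divq_num_den -[y in LHS]divq_num_den.
have [dx dy] : denq x != 0 /\ denq y != 0 by rewrite !denq_eq0.
rewrite -mulNr -rmorphN /= addf_div ?intr_eq0 // -!rmorphM -rmorphD /=.
rewrite pchar0_ratr_frac ?mulf_neq0 // rmorphD !rmorphM rmorphN /=.
by rewrite -addf_div ?pchar0_intr_eq0 // mulNr.
Qed.

Lemma pchar0_ratr_monoid_morphism : monoid_morphism (@ratr F).
Proof.
split=> [|x y]; first exact: ratr_nat 1.
rewrite -[x in LHS]divq_num_den -[y in LHS]divq_num_den.
have [dx dy] : denq x != 0 /\ denq y != 0 by rewrite !denq_eq0.
rewrite mulf_div -!rmorphM pchar0_ratr_frac ?mulf_neq0 // !rmorphM /=.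
by rewrite -mulf_div.
Qed.

(* An alias: [ratr] itself already carries morphism instances, for ordered      *)
(* fields only.                                                               *)
Definition pchar0_ratr : rat -> F := ratr.

HB.instance Definition _ :=
  GRing.isZmodMorphism.Build rat F pchar0_ratr pchar0_ratr_zmod_morphism.
HB.instance Definition _ :=
  GRing.isMonoidMorphism.Build rat F pchar0_ratr pchar0_ratr_monoid_morphism.

End RatrPchar0.

(** Compares the coefficients of t^n / n! in (e^t + 1) * (sum of E_i t^i / i!) = 2. *)
Lemma euler_number_rec (n : nat) :
  \sum_(i < n.+1) 'C(n, i)%:R * euler_number i + euler_number n =
  2 * (n == 0%N)%:R.
Proof.
have fact0 (m : nat) : m`!%:R != 0 :> rat by rewrite pnatr_eq0 -lt0n fact_gt0.
have := congr1 ( *%R n`!%:R) (euler_numberP n); rewrite /fps_exp /fps_const.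
(* The constant 1 of e^t + 1 contributes only at i = n. *)
rewrite (eq_bigr (fun i : 'I_n.+1 =>
  euler_number i / i`!%:R * (n - i)`!%:R^-1 +
  if (i == n :> nat) then euler_number i / i`!%:R else 0)); last first.
  move=> i _ /=; rewrite mulrDr; congr (_ + _).
  rewrite subn_eq0 eqn_leq leq_ord /=.
  by case: ifP; rewrite ?mulr1 ?mulr0.
rewrite big_split /= mulrDr mulr_sumr => e.
transitivity (n`!%:R * (if n == 0%N then 2 else 0 : rat)); last first.
  by case: n {e} => [|n] /=; rewrite ?mul1r ?mulr1 ?mulr0.
rewrite -e; congr (_ + _).
  apply: eq_bigr => i _; have in_ : (i <= n)%N by rewrite -ltnS.
  rewrite -(bin_fact in_) !natrM.
  by field; rewrite !fact0.
rewrite -big_mkcond /= (big_pred1 ord_max) /=; last first.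
  by [].
by rewrite mulrC divfK.
Qed.

(** * Umbral evaluation of polynomials *)

Section Umbral.

Context (F : fieldType) (e : nat -> F).
Implicit Types P Q : {poly F}.

Definition umbral_eval P : F := \sum_(i < size P) P`_i * e i.

Lemma umbral_eval_wide P (n : nat) : (size P <= n)%N ->
  umbral_eval P = \sum_(i < n) P`_i * e i.
Proof.
move=> le; rewrite /umbral_eval (big_ord_widen n (fun i => P`_i * e i) le).
rewrite big_mkcond; apply: eq_bigr => i _; case: ltnP => // h.
by rewrite nth_default ?mul0r.
Qed.

Lemma umbral_eval_is_scalar : scalar umbral_eval.
Proof.
move=> a P Q; pose n := maxn (size P) (size Q).
rewrite !(@umbral_eval_wide _ n) ?leq_maxl ?leq_maxr //; last first.
  rewrite (leq_trans (size_polyD _ _)) // geq_max leq_maxr andbT.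
  by rewrite (leq_trans (size_scale_leq _ _)) // leq_maxl.
rewrite mulr_sumr -big_split /=; apply: eq_bigr => i _.
by rewrite coefD coefZ mulrDl mulrA.
Qed.

HB.instance Definition _ :=
  GRing.isLinear.Build F {poly F} F *%R umbral_eval umbral_eval_is_scalar.

Lemma umbral_evalXn (n : nat) : umbral_eval 'X^n = e n.
Proof.
rewrite /umbral_eval size_polyXn big_ord_recr /= coefXn eqxx mul1r.
rewrite big1 ?add0r //.
by move=> i _; rewrite coefXn ltn_eqF ?mul0r.
Qed.

End Umbral.

(** * The Euler functional under shift and reflection *)

Section EulerEval.

Context (F : fieldType) (F0 : [pchar F] =i pred0).
Implicit Types P Q : {poly F}.

Local Notation E := (umbral_eval (fun n => ratr (euler_number n))).

Let two_neq0 : 2 != 0 :> F. Proof. by rewrite ((pcharf0P F).1 F0). Qed.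

(** By linearity only Q = X^i matters, and there this is the recurrence of the Euler numbers. *)
Lemma euler_eval_shift_sum Q : E (Q \Po ('X + 1) + Q) = 2 * Q.[0].
Proof.
rewrite -[Q]coefK poly_def raddf_sum -big_split /= !raddf_sum /= horner_sum.
rewrite mulr_sumr.
apply: eq_bigr => i _; rewrite comp_polyZ -scalerDr linearZ /= hornerZ hornerXn.
rewrite mulrCA; congr (_ * _); rewrite comp_Xn_poly linearD /= umbral_evalXn.
rewrite addrC exprD1n addrC linear_sum /=.
under eq_bigr do rewrite raddfMn /= umbral_evalXn -mulr_natl.
have := congr1 (pchar0_ratr F) (euler_number_rec i).
rewrite rmorphD rmorph_sum [RHS]rmorphM !rmorph_nat /=.
under eq_bigr do rewrite rmorphM rmorph_nat /=.
by rewrite expr0n => ->.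
Qed.

(** The leading terms cancel. With D P = P(X + 1) - P, the induction rests on D(P X + c) = D(P) (X +
    1) + P. *)
Lemma size_shift_diff P : (size (P \Po ('X + 1) - P)%R <= (size P).-1)%N.
Proof.
elim/poly_ind: P => [|P c IH]; first by rewrite comp_poly0 subr0 size_poly0.
rewrite comp_poly_MXaddC size_MXaddC.
have [->|P0] := eqVneq P 0.
  rewrite comp_poly0 !mul0r subrr size_poly0 //.
rewrite andFb /=.
have -> : (P \Po ('X + 1)) * ('X + 1) + c%:P - (P * 'X + c%:P) =
  (P \Po ('X + 1) - P) * ('X + 1) + P by ring.
apply: leq_trans (size_polyD _ _) _; rewrite geq_max leqnn andbT.
have [->|D0] := eqVneq (P \Po ('X + 1) - P) 0.
  by rewrite mul0r size_poly0.
apply: leq_trans (size_polyMleq _ _) _.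
rewrite -polyC1 size_XaddC addn2 /=.
by apply: leq_ltn_trans IH _; rewrite prednK // size_poly_gt0.
Qed.

(* Putting T P = P(X + 1) + P and D P = P(X + 1) - P, one has T P = 2 P + D P:  *)
(* if T Q = D P, where D P has smaller degree, then T((P - Q)/2) = P.           *)
Lemma shift_sum_surj P : exists Q, Q \Po ('X + 1) + Q = P.
Proof.
have [n] := ubnP (size P); elim: n P => // n IH P.
have [->|P0] := eqVneq P 0; first by exists 0; rewrite comp_poly0 addr0.
rewrite ltnS => sP; have [|Q hQ] := IH (P \Po ('X + 1) - P).
  apply: leq_trans sP; apply: leq_ltn_trans (size_shift_diff P) _.
  by rewrite prednK // size_poly_gt0.
exists (2^-1 *: (P - Q)); rewrite comp_polyZ -scalerDr comp_polyB.
have -> : (P \Po ('X + 1)) - (Q \Po ('X + 1)) + (P - Q) = 2 *: P.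
  rewrite addrACA -opprD hQ scaler_nat; ring.
by rewrite scalerA mulVf // scale1r.
Qed.

(** Up to sign, X -> -1 - X exchanges X and X + 1, so for P = Q(X + 1) + Q(X) both sides are 2
    Q(0). *)
Lemma euler_eval_reflect P : E (P \Po (- 'X - 1)) = E P.
Proof.
have [Q <-] := shift_sum_surj P.
have -> : (Q \Po ('X + 1) + Q) \Po (- 'X - 1) =
    (Q \Po - 'X) \Po ('X + 1) + (Q \Po - 'X).
  rewrite comp_polyD -!comp_polyA addrC. congr (_ + _). congr (_ \Po _).
    by rewrite rmorphN /= comp_polyX opprD.
  congr (_ \Po _).
  by rewrite comp_polyD comp_polyX comp_polyC subrK.
by rewrite !euler_eval_shift_sum horner_comp hornerN hornerX oppr0.
Qed.

Lemma euler_eval_1subX P : E (P \Po (1 - 'X)) = E P + 2 * P.[1] - 2 * P.[0].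
Proof.
(* One shift flips the sign of E; two shifts restore it and leave 2 P(1) - 2 P(0). *)
have shift (R : {poly F}) : E (R \Po ('X + 1)) = 2 * R.[0] - E R.
  by rewrite -euler_eval_shift_sum linearD addrK.
have -> : P \Po (1 - 'X) = ((P \Po ('X + 1)) \Po ('X + 1)) \Po (- 'X - 1).
  rewrite -!comp_polyA; congr (_ \Po _).
  by rewrite !comp_polyD !comp_polyX !comp_polyC; ring.
rewrite euler_eval_reflect !shift horner_comp hornerD hornerX hornerC add0r.
by ring.
Qed.

End EulerEval.

(** * Polynomials over the p-adic numbers and limits of alternating sums *)

Section PadicPoly.

Context (p : nat) (p_pr : prime p).
Local Notation Qp := (padic p_pr).
Implicit Types (P Q : {poly Qp}) (x y : Qp).

(** Since n < p^n, the residue of n modulo p^n is n itself, so n can vanish only if it is 0. *)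
Lemma padic_pchar0 : [pchar Qp] =i pred0.
Proof.
apply/pcharf0P => n; apply/idP/eqP => [|->//].
rewrite -(rmorph_nat (@padic_of_int p p_pr)) /padic_of_int tofrac_eq0.
move=> /eqP/(congr1 (fun a : padic_int p_pr => a n)).
by rewrite residue_nat residue_zero modn_small // ltn_expl // prime_gt1.
Qed.

Lemma padic_norm_ge0 x : 0 <= padic_norm x.
Proof. by have := mdist_ge0 x 0; rewrite padic_mdistE subr0. Qed.

Lemma padic_norm_nat_le1 (n : nat) : padic_norm (n%:R : Qp) <= 1.
Proof.
rewrite -(rmorph_nat (@padic_of_int p p_pr)) padic_norm_int.
have := padic_int_norm_le_exp (n%:R : padic_int p_pr) 0.
by rewrite invr1 residue0 => ->.
Qed.

Lemma padic_norm_exp_le (n : nat) :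
  padic_norm ((p ^ n)%:R : Qp) <= p%:R ^- n.
Proof.
rewrite -(rmorph_nat (@padic_of_int p p_pr)) padic_norm_int.
by rewrite padic_int_norm_le_exp residue_nat modnn.
Qed.

Lemma horner_bounded P :
  exists C, forall x, padic_norm x <= 1 -> padic_norm P.[x] <= C.
Proof.
elim/poly_ind: P => [|P c [C hC]].
  exists 0 => x _; rewrite horner0.
  by have /eqP -> : padic_norm (0 : Qp) == 0 by rewrite padic_norm_eq0.
exists (Num.max C (padic_norm c)) => x x1.
rewrite hornerMXaddC; apply: le_trans (padic_normD _ _) _.
rewrite ge_max !le_max lexx orbT andbT padic_normM; apply/orP; left.
by apply: le_trans (hC x x1); rewrite ler_piMr ?padic_norm_ge0.
Qed.

(** For P X + c the difference of the values at 0 and x is - P(x) x, and P is bounded on the unit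
    ball. *)
Lemma horner_lipschitz0 P : exists C, forall x, padic_norm x <= 1 ->
  padic_norm (P.[0] - P.[x]) <= C * padic_norm x.
Proof.
elim/poly_ind: P => [|P c _].
  exists 0 => x _; rewrite !horner0 subrr mul0r.
  by have /eqP -> : padic_norm (0 : Qp) == 0 by rewrite padic_norm_eq0.
have [C hC] := horner_bounded P; exists C => x x1.
rewrite !hornerMXaddC mulr0 add0r opprD addrCA subrr addr0 padic_normN.
by rewrite padic_normM ler_wpM2r ?padic_norm_ge0 ?hC.
Qed.

Local Open Scope classical_set_scope.

Lemma horner_expn_cvg P : (fun N => P.[(p ^ N)%:R]) @ \oo --> P.[0].
Proof.
have [C hC] := horner_lipschitz0 P.
apply/metricType_numDomainType.cvgrPdist_lt => eps eps0.
(* From this rank on, |C| / eps < N + 1 <= p^N, hence |C| p^(-N) < eps. The absolute value covers a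
   negative C. *)
exists (Num.bound (`|C| / eps)) => // N /= leN; rewrite padic_mdistE.
apply: le_lt_trans (hC _ (padic_norm_nat_le1 _)) _.
apply: le_lt_trans (ler_wpM2r (padic_norm_ge0 _) (ler_norm C)) _.
apply: le_lt_trans (ler_wpM2l (normr_ge0 C) (padic_norm_exp_le N)) _.
have pN0 : 0 < p%:R ^+ N :> rat by rewrite exprn_gt0 // ltr0n prime_gt0.
rewrite ltr_pdivrMr // mulrC -ltr_pdivrMr //.
apply: lt_trans (archi_boundP _) _; first by rewrite divr_ge0 // ltW.
rewrite -natrX ltr_nat; apply: leq_ltn_trans leN _.
by rewrite ltn_expl // prime_gt1.
Qed.

Lemma fermionic_sum_shift_sum Q (N : nat) :
  fermionic_sum
    (fun a : padic_int p_pr => (Q \Po ('X + 1) + Q).[padic_of_int a]) N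
  = Q.[0] - (-1) ^+ (p ^ N) * Q.[(p ^ N)%:R].
Proof.
(* The leading sign makes g(i + 1) - g(i) equal to (-1)^i (Q(i + 1) + Q(i)). *)
pose g i : Qp := - ((-1) ^+ i * Q.[i%:R]).
rewrite /fermionic_sum (eq_big_nat _ _ (F2 := fun i => g i.+1 - g i)).
  rewrite telescope_sumr // /g opprK expr0 mul1r addrC //.
move=> i _; rewrite /g rmorph_nat exprS hornerD horner_comp !hornerE -natr1.
by ring.
Qed.

Lemma fermionic_sum_horner_cvg P : odd p ->
  fermionic_sum (fun a : padic_int p_pr => P.[padic_of_int a]) @ \oo -->
    umbral_eval (fun n => ratr (euler_number n)) P.
Proof.
move=> p_odd; have [Q <-] := shift_sum_surj padic_pchar0 P.
rewrite (euler_eval_shift_sum padic_pchar0).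
apply/metricType_numDomainType.cvgrPdist_lt => eps eps0.
have /metricType_numDomainType.cvgrPdist_lt/(_ eps eps0) := @horner_expn_cvg Q.
apply: filterS => N; rewrite !padic_mdistE fermionic_sum_shift_sum.
(* As p^N is odd, the sum is Q(0) + Q(p^N), at distance |Q(0) - Q(p^N)| from 2 Q(0). *)
rewrite -signr_odd oddX p_odd orbT expr1 mulN1r opprK mulr_natl mulr2n.
by rewrite opprD addrACA subrr add0r.
Qed.

End PadicPoly.

(** * Bernstein products and their integral *)

Lemma bernstein_mul3 (R : comNzRingType) (k n m s : nat) :
  bernstein R k n * bernstein R k m * bernstein R k s =
  ('C(n, k) * 'C(m, k) * 'C(s, k))%:R *:
    ('X^(3 * k) * (1 - 'X) ^+ (n + m + s - 3 * k)).
Proof.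
rewrite /bernstein.
(* If one of n, m, s is below k, both sides vanish through its binomial, whatever the truncated
   exponent; otherwise the exponents add up. *)
case: (leqP k n) => [kn|nk]; last first.
  by rewrite ['C(n, k)]bin_small // !mul0n scale0r !mul0r.
case: (leqP k m) => [km|mk]; last first.
  by rewrite ['C(m, k)]bin_small // muln0 mul0n scale0r mulr0 mul0r.
case: (leqP k s) => [ks|sk]; last first.
  by rewrite ['C(s, k)]bin_small // muln0 scale0r mulr0.
rewrite -!(scalerAl, scalerAr) !scalerA -!natrM; congr (_ *: _).
  by rewrite mulnC.
rewrite [X in X * _]mulrACA [LHS]mulrACA -!exprD.
by congr (_ ^+ _ * _ ^+ _); lia.
Qed.

Theorem theorem8 (p : nat) (p_pr : prime p) (p_odd : odd p)
    (m n s k : nat) (hk : (3 * k < m + n + s)%N) :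
  let f := fun x : padic_int p_pr =>
    (bernstein (padic p_pr) k n).[padic_of_int x] *
    (bernstein (padic p_pr) k m).[padic_of_int x] *
    (bernstein (padic p_pr) k s).[padic_of_int x] in
  fermionic_integrable f /\
  fermionic_integral f =
    if k == 0%N then 2 + ratr (euler_number (n + m + s))
    else 'C(n, k)%:R * 'C(m, k)%:R * 'C(s, k)%:R *
         \sum_(0 <= j < (3 * k).+1)
           'C(3 * k, j)%:R * (-1) ^+ (3 * k - j) *
           ratr (euler_number (n + m + s - j)).
Proof.
move=> f; set rhs := (X in _ = X).
suff fE : (fermionic_sum f @ \oo --> rhs)%classic.
  split; first exact: cvgP fE.
  exact: cvg_lim (@padic_hausdorff p p_pr) _ _ _ _ _ fE.
pose F : fieldType := padic p_pr.
pose P : {poly F} := bernstein F k n * bernstein F k m * bernstein F k s.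
have -> : f = fun x => P.[padic_of_int x].
  by apply/funext => x; rewrite /f /P !hornerM.
suff -> : rhs = umbral_eval (fun i => ratr (euler_number i)) P.
  exact: fermionic_sum_horner_cvg p_odd.
have M_gt : (3 * k < n + m + s)%N by rewrite (addnC n).
pose S : {poly F} := 'X ^+ (n + m + s - 3 * k) * (1 - 'X) ^+ (3 * k).
have PE : P = ('C(n, k) * 'C(m, k) * 'C(s, k))%:R *: (S \Po (1 - 'X)).
  have SE : S \Po (1 - 'X) = (1 - 'X) ^+ (n + m + s - 3 * k) * 'X ^+ (3 * k).
    rewrite /S comp_polyM !rmorphXn /= rmorphB /= rmorph1 comp_polyX.
    by congr (_ * _ ^+ _); ring.
  by rewrite SE /P bernstein_mul3 mulrC.
have SE : umbral_eval (fun i => ratr (euler_number i)) S =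
    \sum_(0 <= j < (3 * k).+1) 'C(3 * k, j)%:R * (-1) ^+ (3 * k - j) *
      ratr (euler_number (n + m + s - j)).
  (* With - X as the first summand, the j-th binomial term carries X^(3k - j), which gives total
     degree M - j. *)
  rewrite /S [1 - 'X]addrC exprDn mulr_sumr linear_sum big_mkord.
  apply: eq_bigr => j _ /=; have j3k : (j <= 3 * k)%N by rewrite -ltnS.
  rewrite expr1n mulr1 [(- 'X) ^+ _]exprNn mulrnAr mulrCA -exprD -mulr_natl.
  have -> : (n + m + s - 3 * k + (3 * k - j) = n + m + s - j)%N by lia.
  rewrite -polyC1 -polyCN -polyC_exp -polyC_natr mulrA -polyCM mul_polyC.
  by rewrite linearZ /= umbral_evalXn.
(* The hypothesis M > 3k makes the exponent of X in S positive. *)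
have S0 : S.[0] = 0.
  by rewrite /S hornerM hornerXn expr0n subn_eq0 leqNgt M_gt mul0r.
have S1 : S.[1] = (k == 0%N)%:R.
  rewrite /S hornerM hornerXn horner_exp !hornerE subrr expr1n mul1r expr0n.
  by rewrite muln_eq0.
rewrite PE linearZ /= (euler_eval_1subX (padic_pchar0 p_pr)) SE S0 S1 /rhs.
(* The boundary term 2 S(1) vanishes for k > 0; for k = 0 it is the 2 of the formula, and the sum
   reduces to E_M. *)
rewrite mulr0 subr0 !natrM; case: eqP => [->|_]; last by rewrite mulr0 addr0.
rewrite !bin0 !mul1r muln0 big_nat1 bin0 subn0 expr0 !mul1r mulr1 subn0.
by rewrite addrC.
Qed.
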